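(* Let $p_1 \neq p_2$ be primes. Let $G = \varprojlim_n \mathbb{Z}/p_2^n\mathbb{Z}$ be the infinite cyclic profinite $p_2$-group and let $F_1/\mathbb{Q}$ be a Galois extension with Galois group $G$. Let $D_1'/\mathbb{Q}$ be a division algebra of degree $p_1$ and put $D_1 = D_1' \otimes_{\mathbb{Q}} F_1$, which is a division algebra over $F_1$ because $F_1/\mathbb{Q}$ is a pro-$p_2$ extension. Let $D_2/\mathbb{Q}$ be any division algebra split by $F_1$. Then there is no division algebra $E/F$ containing both $D_1$ and $D_2$.
   Context: ''$D/F$ is a division algebra'' means that $D$ is a division ring which is finite dimensional over its center $F$. The degree of $D/F$ is $\sqrt{\dim_F D}$. $D_2$ is split by $F_1$ if $D_2 \otimes_{\mathbb{Q}} F_1$ is isomorphic to a matrix algebra over $F_1$.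
   Formalization: The formal statement assumes that D_2 is not Q itself: Q is a division algebra over Q split by F_1, and then E = D_1 over F = F_1 contains both D_1 and D_2, so the claim fails in that case. *)

(* Defs.v *)
From HB Require Import structures.
From mathcomp Require Import all_boot all_order all_algebra all_field.
From mathcomp Require Import boolp classical_sets functions.

Set Implicit Arguments.
Unset Strict Implicit.
Unset Printing Implicit Defensive.

Import GRing.Theory.

Local Open Scope classical_set_scope.
Local Open Scope ring_scope.

(** ** Division algebras *)

(* Finite dimensionality over [F] is part of [falgType F]; the second clause
   says that the center of [D] is the image [1%VS] of [F]. *)
Definition division_algebra (F : fieldType) (D : falgType F) : Prop :=
  (forall x : D, x != 0 -> x \is a GRing.unit) /\ 'Z({:D})%VS = 1%VS.

Definition has_degree (F : fieldType) (D : falgType F) (d : nat) : Prop :=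
  \dim {:D} = (d ^ 2)%N.

(* Containment is only required as rings: the centers need not be related. *)
Definition contains_ring (E D : nzRingType) : Prop :=
  exists f : {rmorphism D -> E}, injective f.

(** ** Extension of scalars [A (x)_K L] along a field embedding [iota : K -> L] *)

Definition balanced (K L : fieldType) (iota : {rmorphism K -> L})
    (A : algType K) (W : zmodType) (f : A -> L -> W) : Prop :=
  [/\ forall a b x, f (a + b) x = f a x + f b x,
      forall a x y, f a (x + y) = f a x + f a y
    & forall k a x, f (k *: a) x = f a (iota k * x)].

(* The [L]-algebra [T], with [t a x] in the role of the pure tensor
   [a (x) x], is the tensor product of the [K]-algebras [A] and [L]: it is the
   universal target of balanced maps, with the product of algebras
   [(a (x) x)(b (x) y) = ab (x) xy] and [L] acting through [1 (x) L]. *)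
Record is_scalar_extension (K L : fieldType) (iota : {rmorphism K -> L})
    (A : algType K) (T : algType L) (t : A -> L -> T) : Prop := {
  tensor_balanced : balanced iota t;
  tensor_lift : forall (W : zmodType) (f : A -> L -> W), balanced iota f ->
    exists g : {additive T -> W}, forall a x, g (t a x) = f a x;
  tensor_unique : forall (W : zmodType) (g1 g2 : {additive T -> W}),
    (forall a x, g1 (t a x) = g2 (t a x)) -> g1 =1 g2;
  tensor_mul : forall a b x y, t a x * t b y = t (a * b) (x * y);
  tensor_scalar : forall x, t 1 x = x%:A
}.

(* [{lrmorphism _ -> _}] makes the isomorphism one of [L]-algebras; matrices
   have positive size [n.+1] because [A (x)_K L] is nonzero. *)
Definition split_by (K L : fieldType) (iota : {rmorphism K -> L})
    (A : algType K) : Prop :=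
  exists (T : algType L) (t : A -> L -> T), is_scalar_extension iota t /\
  exists (n : nat) (h : {lrmorphism T -> 'M[L]_n.+1}), bijective h.

(** ** Possibly infinite Galois extensions *)

(* [p] is the minimal polynomial of [x]: the extension is algebraic, separable
   and normal. *)
Definition galois_extension (K L : fieldType) (iota : {rmorphism K -> L}) :
    Prop :=
  forall x : L, exists p : {poly K},
    [/\ p \is monic, irreducible_poly p, root (map_poly iota p) x,
        separable_poly p
      & exists s : seq L, map_poly iota p = \prod_(z <- s) ('X - z%:P)].

Definition galois_group (K L : fieldType) (iota : {rmorphism K -> L}) :
    set (L -> L) :=
  [set s | [/\ zmod_morphism s, monoid_morphism s, bijective s
             & forall k, s (iota k) = iota k]].

(* Open sets of the Krull topology: the automorphisms agreeing with [s] on the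
   finite set [S] form the coset of [s] modulo Gal(L / K(S)). *)
Definition krull_open (K L : fieldType) (iota : {rmorphism K -> L})
    (U : set (L -> L)) : Prop :=
  forall s, U s -> exists S : seq L,
    forall t, galois_group iota t -> {in S, s =1 t} -> U t.

(** ** The inverse limit of the groups [Z/p^n] *)

(* Component [n] lives in [Z/p^(n+1)], since ['Z_m] is Z/m only for [1 < m];
   omitting the trivial group [Z/p^0] does not change the limit. *)
Definition Zp_seq (p : nat) : Type := forall n : nat, 'Z_(p ^ n.+1).

Definition Zp_red (p n : nat) (a : 'Z_(p ^ n.+2)) : 'Z_(p ^ n.+1) :=
  (nat_of_ord a)%:R.

Definition Zp_lim (p : nat) : set (Zp_seq p) :=
  [set x : Zp_seq p | forall n, Zp_red (x n.+1) = x n].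

(* Open sets of the limit topology, all the [Z/p^n] being discrete. *)
Definition Zp_open (p : nat) (V : set (Zp_seq p)) : Prop :=
  forall x, V x -> exists n : nat, forall y, Zp_lim y ->
    (forall i, (i <= n)%N -> y i = x i) -> V y.

(* [phi] is an isomorphism of topological groups; its values outside
   [galois_group iota] are irrelevant. *)
Definition galois_group_iso_Zp (K L : fieldType) (iota : {rmorphism K -> L})
    (p : nat) : Prop :=
  exists phi : (L -> L) -> Zp_seq p,
    [/\ set_bij (galois_group iota) (@Zp_lim p) phi,
        forall s t, galois_group iota s -> galois_group iota t ->
          forall n, phi (s \o t) n = phi s n + phi t n
      & forall U, U `<=` galois_group iota ->
          (krull_open iota U <-> Zp_open (phi @` U))].

(* Main.v *)
Require Import Defs.
From HB Require Import structures.
From mathcomp Require Import all_boot all_order all_algebra all_fingroup.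
From mathcomp Require Import all_solvable all_field.
From mathcomp Require Import boolp classical_sets functions.
Import GRing.Theory.
Local Open Scope ring_scope.
Set Implicit Arguments.
Unset Strict Implicit.
Unset Printing Implicit Defensive.

(** Write [Q] for the rationals, [L] for [F1] and [H] for its Galois group over
   [Q], which is isomorphic to the [p2]-adic integers.

   No division algebra [E] over [F] contains both [D1] and [D2], because [H] is
   torsion-free. Inside [E], every element of [L] is algebraic over [F] of
   degree at most [m = dim_F E], and since [L] is normal over [Q] its minimal
   polynomial over [F] has coefficients in the intersection [F0] of [L] and [F]
   ([min_poly_descent]). So the subgroup of [H] fixing [F0] has all its orbits
   of size at most [m] and is killed by [m!]; being torsion-free it is trivial
   ([galois_torsionfree]), and then [F0 = L] by Galois theory ([fixed_field]).
   Hence [L] is central in [E] ([procyclic_embeds_centrally]), and the inclusion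
   of [D2] extends to a ring morphism from [D2 (x) L], a matrix algebra of size
   at least [2], to [E]. A nonzero nilpotent matrix generates the unit ideal, so
   its image is a nonzero nilpotent of [E], which is absurd
   ([split_image_nilpotent]).

   That [D1] is a division algebra rests on [H] being [p1]-divisible. Any given
   elements of [D1] come from [D1' (x) Q(theta)] for some [theta] in [L]. The
   group [H] permutes the conjugates of [theta] transitively through a finite
   group in which all elements are [p1]-th powers, so the degree [d] of [theta]
   is prime to [p1] ([galois_degree_coprime]). A left annihilator in
   [D1' (x) Q(theta)] is a vector space both over [D1'] and over [Q(theta)]; its
   dimension over [Q] is divisible by [p1 ^ 2] and by [d], hence by the dimension
   of the whole algebra, so it is zero or everything ([power_sum_annihilator]).

   Both halves use that [H] has enough elements although [L] is infinite over
   [Q]: Zorn's lemma extends any isomorphism between subrings of [L] that fixes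
   [Q] to an element of [H] ([piso_extension]). *)

(** * Extension of isomorphisms in a Galois extension *)

Section PartialIsomorphisms.

Variables (K L : fieldType) (iota : {rmorphism K -> L}).
Hypothesis L_galois : galois_extension iota.

Local Notation "p ^i" := (map_poly iota p) (at level 2, format "p ^i").

Lemma galois_roots (x : L) : exists (p : {poly K}) (s : seq L),
  [/\ irreducible_poly p, p \is monic, p^i = \prod_(z <- s) ('X - z%:P),
      uniq s & x \in s].
Proof.
have [p [p_mon p_irr px p_sep [s Dp]]] := L_galois x.
exists p, s; split=> //.
  by rewrite -separable_prod_XsubC -Dp separable_map.
by rewrite -root_prod_XsubC -Dp.
Qed.

Lemma irreducible_dvdp_root (p f : {poly K}) (x : L) :
  irreducible_poly p -> root p^i x -> root f^i x -> p %| f.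
Proof.
move=> p_irr px fx; apply/negPn; rewrite -irreducible_poly_coprime //.
apply/negP=> /Bezout_eq1_coprimepP[[u v] /= Duv].
have := congr1 (fun q => (q^i).[x]) Duv.
rewrite rmorphD !rmorphM rmorph1 !hornerE (rootP px) (rootP fx) !mulr0 addr0.
by move/eqP; rewrite eq_sym oner_eq0.
Qed.

(** The graph of a [K]-isomorphism between two subrings of [L], a form in which
   the union of a chain is again of the same kind. Single-valuedness is stated at
   [0]; injectivity follows from it by algebraicity, see [piso_cancel]. *)
Record partial_iso (G : set (L * L)) : Prop := {
  piso_base : forall k, G (iota k, iota k);
  piso_sub : forall a b c d, G (a, b) -> G (c, d) -> G (a - c, b - d);
  piso_mul : forall a b c d, G (a, b) -> G (c, d) -> G (a * c, b * d);
  piso_inj : forall b, G (0, b) -> b = 0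
}.

Section OnePartialIso.

Variables (G : set (L * L)) (isoG : partial_iso G).

Lemma piso0 : G (0, 0).
Proof. by have := piso_base isoG 0; rewrite rmorph0. Qed.

Lemma piso1 : G (1, 1).
Proof. by have := piso_base isoG 1; rewrite rmorph1. Qed.

Lemma piso_opp a b : G (a, b) -> G (- a, - b).
Proof. by move=> Gab; rewrite -(sub0r a) -(sub0r b); apply: (piso_sub isoG piso0). Qed.

Lemma piso_add a b c d : G (a, b) -> G (c, d) -> G (a + c, b + d).
Proof.
by move=> Gab Gcd; rewrite -(opprK c) -(opprK d); apply: (piso_sub isoG _ (piso_opp _)).
Qed.

Lemma piso_sum n (F1 F2 : 'I_n -> L) :
  (forall i, G (F1 i, F2 i)) -> G (\sum_i F1 i, \sum_i F2 i).
Proof.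
move=> GF; apply: (big_ind2 (fun a b => G (a, b))) => //; first exact: piso0.
by move=> a b c d; apply: piso_add.
Qed.

Definition piso_poly (f g : {poly L}) : Prop := forall i, G (f`_i, g`_i).

Lemma piso_polyM f g f' g' :
  piso_poly f g -> piso_poly f' g' -> piso_poly (f * f') (g * g').
Proof.
move=> Gfg Gfg' i; rewrite !coefM; apply: piso_sum => j.
by apply: (piso_mul isoG).
Qed.

Lemma piso_polyB f g f' g' :
  piso_poly f g -> piso_poly f' g' -> piso_poly (f - f') (g - g').
Proof. by move=> Gfg Gfg' i; rewrite !coefB; apply: (piso_sub isoG). Qed.

Lemma piso_polyC a b : G (a, b) -> piso_poly a%:P b%:P.
Proof. by move=> Gab i; rewrite !coefC; case: eqP => // _; apply: piso0. Qed.

Lemma piso_polyXn n : piso_poly 'X^n 'X^n.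
Proof.
by move=> i; rewrite !coefXn; case: eqP => _; [apply: piso1 | apply: piso0].
Qed.

Lemma piso_poly_base (f : {poly K}) : piso_poly f^i f^i.
Proof. by move=> i; rewrite !coef_map; apply: (piso_base isoG). Qed.

Lemma piso_horner_base (f : {poly K}) a b :
  G (a, b) -> G (f^i.[a], f^i.[b]).
Proof.
move=> Gab; elim/poly_ind: f => [|f c IHf].
  by rewrite rmorph0 !horner0; apply: piso0.
rewrite !rmorphD !rmorphM /= !map_polyX !map_polyC.
rewrite !hornerD !hornerM !hornerX !hornerC.
by apply: piso_add; [apply: (piso_mul isoG) | apply: (piso_base isoG)].
Qed.

(** With [p] the minimal polynomial of [a], this exhibits [- n(a) / c] as the
   inverse of [a], so that rings between [K] and [L] are fields. *)
Lemma algebraic_inverse (a : L) : a != 0 -> exists (p n : {poly K}) (c : K),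
  [/\ c != 0, p = n * 'X + c%:P & p^i.[a] = 0].
Proof.
move=> a_neq0; have [p [s [p_irr _ Dp _ s_a]]] := galois_roots a.
have pa: root p^i a by rewrite Dp root_prod_XsubC.
have /factor_theorem[n Dn]: root (p - (p.[0])%:P) 0.
  by rewrite /root !hornerE subrr.
exists p, n, p.[0]; split; last exact/rootP.
  apply: contra_neq a_neq0 => p0.
  have /irreducible_dvdp_root-/(_ 'X _ pa): irreducible_poly p by [].
  have: p %= 'X.
    rewrite eqp_sym; apply: p_irr.2; first by rewrite size_polyX.
    by rewrite -[X in X %| _]subr0 -polyC0 dvdp_XsubCl; apply/rootP.
  rewrite -(eqp_map iota) map_polyX => /eqp_root/(_ a).
  by rewrite pa rootX => /esym/eqP.
by apply/eqP; rewrite -subr_eq Dn subr0.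
Qed.

(** The minimal polynomial of [a != 0] does not vanish at [0], whereas the partner
   [0] of [a] is a root of it. *)
Lemma piso_cancel a : G (a, 0) -> a = 0.
Proof.
move=> Ga0; apply/eqP/negPn/negP=> /algebraic_inverse[p [n [c [c_neq0 Dp pa]]]].
have:= piso_horner_base p Ga0; rewrite pa => /(piso_inj isoG).
rewrite Dp rmorphD rmorphM /= map_polyX map_polyC !hornerE => /eqP.
by rewrite fmorph_eq0 (negPf c_neq0).
Qed.

Lemma piso_inv a b : G (a, b) -> a != 0 -> G (a^-1, b^-1).
Proof.
move=> Gab a0; have [p [n [c [c0 Dp pa]]]] := algebraic_inverse a0.
have pb: p^i.[b] = 0.
  by have:= piso_horner_base p Gab; rewrite pa => /(piso_inj isoG).
have b0: b != 0.
  by apply: contraNneq a0 => b0; rewrite b0 in Gab; rewrite (piso_cancel Gab).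
have inv_z z : z != 0 -> p^i.[z] = 0 -> z^-1 = - n^i.[z] * iota c^-1.
  move=> z0; rewrite Dp rmorphD rmorphM /= map_polyX map_polyC !hornerE.
  move/eqP; rewrite addr_eq0 => /eqP nz.
  apply: (mulIf z0); rewrite mulVf // mulrAC mulNr nz opprK fmorphV divff //.
  by rewrite fmorph_eq0.
rewrite (inv_z a a0 pa) (inv_z b b0 pb).
apply: (piso_mul isoG); last exact: piso_base.
exact/piso_opp/piso_horner_base.
Qed.

Lemma piso_fun x y y' : G (x, y) -> G (x, y') -> y = y'.
Proof.
move=> Gxy Gxy'; apply/subr0_eq/(piso_inj isoG).
by rewrite -(subrr x); apply: (piso_sub isoG).
Qed.

Lemma piso_size f g : piso_poly f g -> size f = size g.
Proof.
move=> Gfg; have f0 i : (f`_i == 0) = (g`_i == 0).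
  apply/eqP/eqP=> [fi | gi]; have:= Gfg i.
    by rewrite fi => /(piso_inj isoG).
  by rewrite gi => /piso_cancel.
apply/eqP; rewrite eqn_leq; apply/andP; split; apply/leq_sizeP=> i le_i;
  apply/eqP; [rewrite f0 | rewrite -f0]; by rewrite nth_default.
Qed.

(** The ring generated by [G] and the pair [(x, y)]. *)
Definition adjoin_pair (x y : L) : set (L * L) :=
  [set u | exists f g, piso_poly f g /\ u = (f.[x], g.[y])].

Lemma adjoin_pair_sub x y u : G u -> adjoin_pair x y u.
Proof.
case: u => a b Gab; exists a%:P, b%:P; split; first exact: piso_polyC.
by rewrite !hornerC.
Qed.

Lemma adjoin_pair_mem x y : adjoin_pair x y (x, y).
Proof.
exists 'X, 'X; split; first exact: (piso_polyXn 1).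
by rewrite !hornerX.
Qed.

Lemma adjoin_pair_iso x y :
    (forall f g, piso_poly f g -> f.[x] = 0 -> g.[y] = 0) ->
  partial_iso (adjoin_pair x y).
Proof.
move=> xy0; split.
- by move=> k; apply/adjoin_pair_sub/(piso_base isoG).
- move=> _ _ _ _ [f [g [Gfg [-> ->]]]] [f' [g' [Gfg' [-> ->]]]].
  by exists (f - f'), (g - g'); split; [apply: piso_polyB | rewrite !hornerE].
- move=> _ _ _ _ [f [g [Gfg [-> ->]]]] [f' [g' [Gfg' [-> ->]]]].
  by exists (f * f'), (g * g'); split; [apply: piso_polyM | rewrite !hornerE].
by move=> b [f [g [Gfg [/esym fx ->]]]]; apply: xy0 Gfg fx.
Qed.

(** Euclidean division by a polynomial [q1] of least degree killing [x] over the
   domain of [G]. Each step uses coefficients of the domain, so it can be carried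
   out simultaneously on the transported polynomials. *)
Lemma piso_min_poly x : exists q1 q2, [/\ piso_poly q1 q2, q1 != 0, q1.[x] = 0
  & forall f g, piso_poly f g -> f.[x] = 0 ->
      exists h1 h2, [/\ f = h1 * q1, g = h2 * q2 & piso_poly h1 h2]].
Proof.
pose P m := `[< exists f g, [/\ piso_poly f g, f != 0, f.[x] = 0 & size f = m] >].
have exP: exists m, P m.
  have [p [s [p_irr _ Dp _ s_x]]] := galois_roots x.
  exists (size p^i); apply/asboolP; exists p^i, p^i; split=> //.
  - exact: piso_poly_base.
  - by rewrite map_poly_eq0 irredp_neq0.
  by apply/rootP; rewrite Dp root_prod_XsubC.
case: (ex_minnP exP) => m /asboolP[q1 [q2 [Gq q1_neq0 q1x <-]]] min_q {m exP}.
exists q1, q2; split=> // f g; have [n] := ubnP (size f).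
elim: n f g => // n IHn f g le_fn Gfg fx.
have [f0 | f_neq0] := eqVneq f 0.
  exists 0, 0; rewrite !mul0r; split=> // [|i]; last by rewrite coef0; apply: piso0.
  by apply/eqP; rewrite -size_poly_eq0 -(piso_size Gfg) f0 size_poly0.
have le_qf: (size q1 <= size f)%N by apply/min_q/asboolP; exists f, g.
pose k := (size f - size q1)%N.
pose a := lead_coef f / lead_coef q1; pose b := lead_coef g / lead_coef q2.
have Gab: G (a, b).
  apply: (piso_mul isoG); first by rewrite !lead_coefE -(piso_size Gfg).
  apply: piso_inv; last by rewrite lead_coef_eq0.
  by rewrite !lead_coefE -(piso_size Gq).
have Gh: piso_poly (a%:P * 'X^k) (b%:P * 'X^k).
  by apply: piso_polyM (piso_polyXn _); apply: piso_polyC.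
have Gr := piso_polyB Gfg (piso_polyM Gh Gq).
have a0: a != 0 by rewrite mulf_neq0 ?invr_eq0 ?lead_coef_eq0.
have sz_hq: size (a%:P * 'X^k * q1) = size f.
  rewrite -mulrA mul_polyC size_scale // mulrC size_mulXn //.
  by rewrite subnK.
have lead_hq: (a%:P * 'X^k * q1)`_(size f).-1 = lead_coef f.
  rewrite -sz_hq -lead_coefE !lead_coefM lead_coefC lead_coefXn mulr1 divfK //.
  by rewrite lead_coef_eq0.
have lt_r: (size (f - a%:P * 'X^k * q1)%R < size f)%N.
  have f_gt0: (0 < size f)%N by rewrite size_poly_gt0.
  rewrite -[X in (_ < X)%N](prednK f_gt0) ltnS; apply/leq_sizeP => j.
  rewrite leq_eqVlt => /predU1P[<- | lt_j].
    by rewrite coefB lead_hq lead_coefE subrr.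
  rewrite (prednK f_gt0) in lt_j.
  by rewrite coefB !nth_default ?subrr // sz_hq.
have [| | h1 [h2 [D1 D2 Gh']]] := IHn _ _ _ Gr.
- exact: leq_trans lt_r _.
- by rewrite hornerD hornerN hornerM q1x mulr0 fx subrr.
exists (h1 + a%:P * 'X^k), (h2 + b%:P * 'X^k); split.
- by rewrite mulrDl -D1 subrK.
- by rewrite mulrDl -D2 subrK.
by move=> i; rewrite !coefD; apply: piso_add.
Qed.

(** The admissible images of [x] are the roots of the transport [q2] of its minimal
   polynomial over the domain of [G]. This [q2] divides a polynomial with distinct
   roots, all in [L], and has degree at least [2] as [x] is not in the domain: so
   a prescribed value [y0] can be avoided. *)
Lemma piso_step x y0 : (forall y, ~ G (x, y)) ->
  exists2 y, y != y0 & partial_iso (adjoin_pair x y).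
Proof.
move=> x_notin; have [q1 [q2 [Gq q1_neq0 q1x q_dvd]]] := piso_min_poly x.
have [p [s [p_irr _ Dp Us s_x]]] := galois_roots x.
have [|h1 [h2 [_ Dq2 _]]] := q_dvd _ _ (piso_poly_base p).
  by apply/rootP; rewrite Dp root_prod_XsubC.
have /dvdp_prod_XsubC[m Dq2m]: q2 %| \prod_(z <- s) ('X - z%:P).
  by rewrite -Dp Dq2 dvdp_mull.
(* If q1 had degree one, its root x would lie in the domain of G. *)
have sz_q2: (2 < size q2)%N.
  rewrite -(piso_size Gq) ltn_neqAle eq_sym; apply/andP; split; last first.
    by rewrite ltnNge; apply: contra_eqN q1x => /size1_polyC-Dq1;
       rewrite Dq1 hornerC; apply: contraNneq q1_neq0 => q10; rewrite Dq1 q10.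
  apply/eqP=> sz2; have q11: q1`_1 != 0.
    by have:= q1_neq0; rewrite -lead_coef_eq0 lead_coefE sz2.
  have Dx: x = - q1`_0 / q1`_1.
    apply: (mulIf q11); rewrite divfK //; apply/eqP; rewrite -addr_eq0 addrC; apply/eqP.
    have:= q1x; rewrite horner_coef sz2 big_ord_recl big_ord1 /= expr0 mulr1 expr1.
    by rewrite [x * _]mulrC.
  apply: (x_notin (- q2`_0 / q2`_1)); rewrite Dx; apply: (piso_mul isoG).
    exact: piso_opp.
  exact: piso_inv.
have [y s_y y_neq]: exists2 y, y \in mask m s & y != y0.
  have:= eqp_size Dq2m; rewrite size_prod_XsubC => Dsz.
  have:= mask_uniq Us m; rewrite Dsz ltnS in sz_q2.
  case: (mask m s) sz_q2 => [|y1 [|y2 r]] //= _.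
  rewrite inE negb_or -andbA => /and3P[y12 _ _].
  have [Dy1 | ] := eqVneq y1 y0; last by exists y1; rewrite ?inE ?eqxx.
  by exists y2; rewrite ?inE ?eqxx ?orbT // -Dy1 eq_sym.
exists y => //; apply: adjoin_pair_iso => f g Gfg fx.
have [k1 [k2 [_ -> _]]] := q_dvd f g Gfg fx.
apply/rootP; rewrite rootM; apply/orP; right.
by rewrite (eqp_root Dq2m) root_prod_XsubC.
Qed.

End OnePartialIso.

Lemma piso_transpose G : partial_iso G -> partial_iso [set u | G (u.2, u.1)]%classic.
Proof.
move=> isoG; split=> /=.
- exact: piso_base.
- by move=> a b c d Gab Gcd; apply: piso_sub.
- by move=> a b c d Gab Gcd; apply: piso_mul.
exact: piso_cancel.
Qed.

(** [G] is added to each member of the chain because Zorn's lemma bounds the empty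
   chain as well. *)
Lemma piso_maximal (G : set (L * L)) : partial_iso G ->
  exists M : set (L * L), [/\ partial_iso M, (G `<=` M)%classic
    & forall N, partial_iso N -> (M `<=` N)%classic -> (N `<=` M)%classic].
Proof.
move=> isoG; pose P := [set A : set (L * L) | partial_iso (A `|` G)%classic]%classic.
have [F FP Ftot|M [PM maxM]] := @Zorn_bigcup _ P.
  pose U := (\bigcup_(X in F) X `|` G)%classic.
  have sXU X : F X -> ((X `|` G) `<=` U)%classic.
    by move=> FX u [Xu | Gu]; [left; exists X | right].
  have sG0 : ((set0 `|` G) `<=` U)%classic by move=> u [//|]; right.
  have P0 : partial_iso (set0 `|` G)%classic by rewrite set0U.
  have U2 u v : U u -> U v -> exists X, [/\ partial_iso (X `|` G)%classic,
     (X `|` G)%classic u, (X `|` G)%classic v & ((X `|` G) `<=` U)%classic].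
    move=> [[X FX Xu] | Gu] [[Y FY Yv] | Gv].
    - case: (Ftot X Y FX FY) => [XY | YX]; [exists Y | exists X].
        split; [exact: FP | by left; apply: XY | by left | exact: sXU].
      split; [exact: FP | by left | by left; apply: YX | exact: sXU].
    - exists X; split; [exact: FP | by left | by right | exact: sXU].
    - exists Y; split; [exact: FP | by right | by left | exact: sXU].
    by exists set0; split=> //; right.
  split.
  - by move=> k; right; apply: piso_base.
  - move=> a b c d Uab Ucd; have [X [isoX Xab Xcd sXU']] := U2 _ _ Uab Ucd.
    exact/sXU'/(piso_sub isoX).
  - move=> a b c d Uab Ucd; have [X [isoX Xab Xcd sXU']] := U2 _ _ Uab Ucd.
    exact/sXU'/(piso_mul isoX).
  move=> b U0b; have [X [isoX X0b _ _]] := U2 _ _ U0b U0b.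
  exact: (piso_inj isoX).
exists (M `|` G)%classic; split=> // N isoN sMN.
have sMG : (N `|` G = N)%classic.
  by apply/setUidl => u Gu; apply: sMN; right.
apply: contrapT => nsNM; apply: (maxM N); last by rewrite /P /= sMG.
split; first by move=> u Mu; apply: sMN; left.
by move=> sNM; apply: nsNM => u /sNM; left.
Qed.

(** By [piso_step] a maximal partial isomorphism is defined everywhere; so is its
   transpose, which is also maximal and provides the inverse. *)
Lemma piso_extension G : partial_iso G -> exists2 sigma : L -> L,
  galois_group iota sigma & forall x y, G (x, y) -> sigma x = y.
Proof.
move=> /piso_maximal[M [isoM sGM maxM]].
have total N : partial_iso N ->
    (forall N', partial_iso N' -> (N `<=` N')%classic -> (N' `<=` N)%classic) ->
  forall x, exists y, N (x, y).
  move=> isoN maxN x; apply: contrapT => /forallNP xN.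
  have [y _ isoN'] := piso_step isoN 0 xN; apply: (xN y).
  apply: (maxN _ isoN'); last exact: adjoin_pair_mem.
  by move=> u; apply: adjoin_pair_sub.
have [sigma sigmaP] := choice (total M isoM maxM).
have [|tau tauP] := choice (total _ (piso_transpose isoM) _).
  move=> N isoN sMN [y x] Nyx; apply: (maxM _ (piso_transpose isoN)) => //.
  by move=> [x' y'] Mxy; apply: sMN.
have sigmaE x y : M (x, y) -> sigma x = y by apply: piso_fun.
exists sigma; last by move=> x y /sGM/sigmaE.
split.
- by move=> x y; apply/sigmaE; apply: (piso_sub isoM).
- split=> [|x y]; apply/sigmaE; first exact: piso1.
  by apply: (piso_mul isoM).
- exists tau => [x | y]; last exact/sigmaE/tauP.
  exact: (piso_fun (piso_transpose isoM)) (tauP (sigma x)) (sigmaP x).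
by move=> k; apply/sigmaE; apply: (piso_base isoM).
Qed.

(** If [x] were outside of [F0], the identity of [F0] could be extended by sending
   [x] to some [y != x], and then to an automorphism. *)
Lemma fixed_field (F0 : set L) (x : L) :
    (forall k, F0 (iota k)) -> (forall a b, F0 a -> F0 b -> F0 (a - b)) ->
    (forall a b, F0 a -> F0 b -> F0 (a * b)) ->
    (forall sigma, galois_group iota sigma -> (forall a, F0 a -> sigma a = a) ->
       sigma x = x) ->
  F0 x.
Proof.
move=> F0_base F0_sub F0_mul fix_x; apply: contrapT => F0'x.
pose G := [set u : L * L | F0 u.1 /\ u.2 = u.1]%classic.
have isoG : partial_iso G.
  split=> /=.
  - by move=> k; split; [apply: F0_base |].
  - by move=> a b c d [/= Fa ->] [/= Fc ->]; split; [apply: F0_sub |].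
  - by move=> a b c d [/= Fa ->] [/= Fc ->]; split; [apply: F0_mul |].
  by move=> b [].
have [|y y_neq isoG1] := @piso_step G isoG x x; first by move=> y [].
have [sigma gal_sigma sigmaE] := piso_extension isoG1.
case/eqP: y_neq; rewrite -(sigmaE x y); last exact: (adjoin_pair_mem isoG).
apply: fix_x => // a F0a.
by apply/sigmaE/(adjoin_pair_sub isoG).
Qed.

(** A polynomial over [K] that vanishes at [x] is a multiple of [p], hence vanishes
   at [y]; this makes [x |-> y] a partial isomorphism. *)
Lemma galois_transitive (p : {poly K}) x y :
    irreducible_poly p -> root p^i x -> root p^i y ->
  exists2 sigma, galois_group iota sigma & sigma x = y.
Proof.
move=> p_irr px py; pose G := [set u : L * L | exists k, u = (iota k, iota k)]%classic.
have isoG : partial_iso G.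
  split=> /=.
  - by move=> k; exists k.
  - by move=> _ _ _ _ [k [-> ->]] [l [-> ->]]; exists (k - l); rewrite rmorphB.
  - by move=> _ _ _ _ [k [-> ->]] [l [-> ->]]; exists (k * l); rewrite rmorphM.
  by move=> b [k [<- ->]].
have [sigma gal_sigma sigmaE] : exists2 sigma, galois_group iota sigma &
    forall a b, adjoin_pair G x y (a, b) -> sigma a = b.
  apply/piso_extension/adjoin_pair_iso => // f g Gfg fx.
  have [f' [Df Dg]]: exists f' : {poly K}, f = f'^i /\ g = f'^i.
    have [c cP] := choice Gfg.
    pose f' := \poly_(i < size f) c i; exists f'.
    have cf i : f`_i = iota (c i) by have [] := cP i.
    have cg i : g`_i = iota (c i) by have [] := cP i.
    have Df : f = f'^i.
      apply/polyP=> i; rewrite coef_map coef_poly; case: ltnP => [_ | le_fi]; first exact: cf.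
      by rewrite nth_default // (raddf0 iota).
    by split=> //; rewrite -Df; apply/polyP=> i; rewrite cf cg.
  have p_f' : p %| f' by apply: irreducible_dvdp_root px _ => //; rewrite -Df; apply/rootP.
  rewrite Dg; apply/rootP; rewrite -dvdp_XsubCl.
  by apply: dvdp_trans (_ : p^i %| _); rewrite ?dvdp_XsubCl ?dvdp_map.
by exists sigma => //; apply/sigmaE/(adjoin_pair_mem isoG).
Qed.

End PartialIsomorphisms.

(** * Automorphisms and p-adic integers *)

Section GaloisGroup.

Variables (K L : fieldType) (iota : {rmorphism K -> L}).

Lemma galois_rmorphism (sigma : L -> L) : galois_group iota sigma ->
  exists f : {rmorphism L -> L}, f = sigma :> (L -> L).
Proof.
case=> sigmaB sigmaM _ _.
pose ha := GRing.isZmodMorphism.Build L L sigma sigmaB.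
pose hm := GRing.isMonoidMorphism.Build L L sigma sigmaM.
by exists (HB.pack_for {rmorphism L -> L} sigma ha hm).
Qed.

Lemma galois_root (sigma : L -> L) (p : {poly K}) x :
  galois_group iota sigma -> root (map_poly iota p) x ->
  root (map_poly iota p) (sigma x).
Proof.
move=> gal_s; have [f Df] := galois_rmorphism gal_s.
have [_ _ _ fix_s] := gal_s.
move=> /rootP px; apply/rootP.
rewrite -Df -[X in horner X](_ : map_poly f (map_poly iota p) = _).
  by rewrite horner_map px rmorph0.
by apply/polyP=> i; rewrite !coef_map /= Df.
Qed.

Lemma galois_id : galois_group iota id.
Proof. by split=> //; exists id. Qed.

Lemma galois_comp (s t : L -> L) :
  galois_group iota s -> galois_group iota t -> galois_group iota (s \o t).
Proof.
move=> [sB [s1 sM] s_bij s_fix] [tB [t1 tM] t_bij t_fix]; split.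
- by move=> x y /=; rewrite tB sB.
- by split=> [|x y] /=; rewrite ?t1 ?s1 // tM sM.
- exact: bij_comp.
by move=> k /=; rewrite t_fix.
Qed.

Lemma galois_iter (s : L -> L) k :
  galois_group iota s -> galois_group iota (iter k s).
Proof.
move=> gal_s; elim: k => [|k IHk]; first exact: galois_id.
exact: galois_comp gal_s IHk.
Qed.

End GaloisGroup.

Section PadicIntegers.

Variable p : nat.
Hypothesis p_prime : prime p.

Lemma Zp_modulus_gt1 n : (1 < p ^ n.+1)%N.
Proof. by rewrite (leq_trans (prime_gt1 p_prime)) // expnS leq_pmulr // expn_gt0 prime_gt0. Qed.

Lemma Zp_nat_eq0 n m : ((m%:R : 'Z_(p ^ n.+1)) == 0) = (p ^ n.+1 %| m)%N.
Proof. by rewrite -val_eqE /= val_Zp_nat ?Zp_modulus_gt1. Qed.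

Lemma Zp_modn n k m : (n <= k)%N ->
  ((m %% p ^ k.+1)%N%:R : 'Z_(p ^ n.+1)) = m%:R.
Proof.
move=> le_nk; rewrite -(Zp_nat_mod (Zp_modulus_gt1 n)).
rewrite -[RHS](Zp_nat_mod (Zp_modulus_gt1 n)); congr (_%:R).
by rewrite modn_dvdm // dvdn_exp2l.
Qed.

Lemma Zp_red_nat n m : Zp_red (m%:R : 'Z_(p ^ n.+2)) = m%:R.
Proof. by rewrite /Zp_red val_Zp_nat ?Zp_modulus_gt1 ?Zp_modn. Qed.

Lemma Zp_red_mulrn n (a : 'Z_(p ^ n.+2)) k : Zp_red (a *+ k) = Zp_red a *+ k.
Proof. by rewrite -[a]natr_Zp -mulrnA !Zp_red_nat mulrnA. Qed.

Lemma Zp_natr_unit n q : prime q -> q <> p -> (q%:R : 'Z_(p ^ n.+1)) \is a GRing.unit.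
Proof.
move=> q_prime q_neq; rewrite unitZpE ?Zp_modulus_gt1 // coprimeXl //.
by rewrite prime_coprime // dvdn_prime2 // eq_sym; apply/eqP.
Qed.

(** [q] is invertible modulo every power of [p]. *)
Lemma Zp_divisible q (x : Zp_seq p) : prime q -> q <> p -> Zp_lim x ->
  exists2 y, Zp_lim y & forall n, y n *+ q = x n.
Proof.
move=> q_prime q_neq lim_x; have q_unit n := Zp_natr_unit n q_prime q_neq.
pose y : Zp_seq p := fun n => x n / q%:R.
have yq n : y n *+ q = x n by rewrite -[LHS]mulr_natr (divrK (q_unit n)).
exists y => // n; apply: (mulIr (q_unit n)).
rewrite !mulr_natr -Zp_red_mulrn !yq; apply: lim_x.
Qed.

(** If [p ^ a] is the [p]-part of [k], then [x (a + n) *+ k = 0] forces [p ^ n.+1] to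
   divide [x (a + n)], whose residue modulo [p ^ n.+1] is [x n]. *)
Lemma Zp_torsionfree (x : Zp_seq p) k : Zp_lim x -> (0 < k)%N ->
  (forall n, x n *+ k = 0) -> forall n, x n = 0.
Proof.
move=> lim_x k_gt0 xk n.
have x_shift a : x n = (nat_of_ord (x (a + n)%N))%:R.
  elim: a => [|a IHa]; first by rewrite natr_Zp.
  rewrite IHa -(lim_x (a + n)%N) /Zp_red val_Zp_nat ?Zp_modulus_gt1 //.
  by rewrite Zp_modn // leq_addl.
pose a := logn p k; pose m := nat_of_ord (x (a + n)%N).
apply/eqP; rewrite (x_shift a) -/m Zp_nat_eq0.
have: (p ^ (a + n).+1 %| m * k)%N.
  by rewrite -Zp_nat_eq0 mulrnA natr_Zp xk.
have [k' p'k' Dk] := pfactor_coprime p_prime k_gt0.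
rewrite Dk -/a mulnA -addnS expnD [X in (_ %| X)%N]mulnC dvdn_pmul2l ?expn_gt0 ?prime_gt0 //.
by rewrite Gauss_dvdl // coprimeXl.
Qed.

End PadicIntegers.

(** * Galois groups isomorphic to the p-adic integers *)

Section ProcyclicGaloisGroup.

Variables (K L : fieldType) (iota : {rmorphism K -> L}) (p : nat).
Hypotheses (p_prime : prime p) (gal_Zp : galois_group_iso_Zp iota p).

Lemma galois_group_Zp : exists phi : (L -> L) -> Zp_seq p,
  [/\ set_bij (galois_group iota) (@Zp_lim p) phi,
      forall n, phi id n = 0
    & forall s k n, galois_group iota s -> phi (iter k s) n = phi s n *+ k].
Proof.
have [phi [phi_bij phiD _]] := gal_Zp; have gal1 := galois_id iota.
have phi1 n : phi id n = 0.
  by apply: (addrI (phi id n)); rewrite -phiD // addr0.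
exists phi; split=> // s k n gal_s; elim: k => [|k IHk]; first exact: phi1.
by rewrite -[iter k.+1 s]/(s \o iter k s) phiD ?IHk ?mulrS //; apply: galois_iter.
Qed.

Lemma galois_divisible q (s : L -> L) : prime q -> q <> p -> galois_group iota s ->
  exists2 t, galois_group iota t & iter q t = s.
Proof.
move=> q_prime q_neq gal_s.
have [phi [[phi_lim phi_inj phi_surj] _ phiX]] := galois_group_Zp.
have [y lim_y yq] := Zp_divisible p_prime q_prime q_neq (phi_lim s gal_s).
have [t gal_t Dy] := phi_surj y lim_y.
exists t => //; apply: phi_inj; rewrite ?in_setE //; first exact: galois_iter.
by apply: functional_extensionality_dep => n; rewrite phiX // Dy yq.
Qed.

Lemma galois_torsionfree k (s : L -> L) : (0 < k)%N -> galois_group iota s ->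
  (forall x, iter k s x = x) -> forall x, s x = x.
Proof.
move=> k_gt0 gal_s sk1.
have [phi [[phi_lim phi_inj _] phi1 phiX]] := galois_group_Zp.
suffices ->: s = id by [].
apply: phi_inj; rewrite ?in_setE //; first exact: galois_id.
apply: functional_extensionality_dep => n; rewrite phi1.
apply: (Zp_torsionfree p_prime (phi_lim s gal_s) k_gt0) => {}n.
by rewrite -phiX // (_ : iter k s = id) ?phi1 //; apply: funext.
Qed.

(** The group induced on the roots of [f] is transitive, so its order is a
   multiple of the degree of [f]. All its elements are [q]-th powers, so raising to
   the power [q] is injective on it, and Cauchy's theorem shows that [q] does not
   divide its order. *)
Lemma galois_degree_coprime q (f : {poly K}) (s : seq L) :
    galois_extension iota -> prime q -> q <> p -> irreducible_poly f ->
    map_poly iota f = \prod_(z <- s) ('X - z%:P) -> uniq s ->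
  coprime q (size s).
Proof.
move=> L_galois q_prime q_neq f_irr Df Us; set d := size s.
have root_s z : (z \in s) = root (map_poly iota f) z by rewrite Df root_prod_XsubC.
pose rt (i : 'I_d) := s`_i.
have rt_s i : rt i \in s by rewrite mem_nth.
have rt_inj : injective rt.
  by move=> i j /eqP; rewrite nth_uniq // => /eqP/val_inj.
have rtP z : z \in s -> exists i, rt i = z.
  move=> s_z; have lt_z : (index z s < d)%N by rewrite index_mem.
  by exists (Ordinal lt_z); rewrite /rt /= nth_index.
pose acts (pi : 'S_d) sigma := forall i, sigma (rt i) = rt (pi i).
have acts_ex sigma : galois_group iota sigma -> exists pi, acts pi sigma.
  move=> gal_s; have s_rt i : sigma (rt i) \in s by rewrite root_s galois_root -?root_s.
  have [c cP] := choice (fun i => rtP _ (s_rt i)).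
  have c_inj : injective c.
    move=> i j Dc; apply: rt_inj; have [_ _ /bij_inj s_inj _] := gal_s.
    by apply: s_inj; rewrite -!cP Dc.
  by exists (perm c_inj) => i; rewrite permE.
have acts_uniq pi pi' sigma : acts pi sigma -> acts pi' sigma -> pi = pi'.
  by move=> a a'; apply/permP => i; apply: rt_inj; rewrite -a -a'.
have acts_iter pi sigma k : acts pi sigma -> acts (pi ^+ k)%g (iter k sigma).
  move=> a; elim: k => [|k IHk] i; first by rewrite expg0 perm1.
  by rewrite /= IHk a expgSr permM.
pose Gam := finset (fun pi : 'S_d =>
  `[< exists2 sigma, galois_group iota sigma & acts pi sigma >]).
have GamP pi :
    reflect (exists2 sigma, galois_group iota sigma & acts pi sigma) (pi \in Gam).
  by rewrite inE; apply: asboolP.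
have Gam_group : group_set Gam.
  apply/group_setP; split.
    by apply/GamP; exists id; [apply: galois_id | move=> i; rewrite perm1].
  move=> u v /GamP[su gal_su au] /GamP[sv gal_sv av]; apply/GamP.
  by exists (sv \o su) => [|i]; [apply: galois_comp | rewrite /= au av permM].
pose G := Group Gam_group.
have G_pow pi : pi \in G -> exists2 rho, rho \in G & (rho ^+ q)%g = pi.
  move=> /GamP[sigma gal_s a].
  have [tau gal_t Dtau] := galois_divisible q_prime q_neq gal_s.
  have [rho arho] := acts_ex _ gal_t; exists rho; first by apply/GamP; exists tau.
  by apply: (acts_uniq _ _ sigma) => //; rewrite -Dtau; apply: acts_iter.
have q'G : coprime q #|G|.
  rewrite prime_coprime //; apply/negP=> /(Cauchy q_prime)[x Gx ox].
  have sqG : [set (y ^+ q)%g | y in G] = G :> {set 'S_d}.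
    apply/setP => y; apply/imsetP/idP => [[z Gz ->] | Gy]; first exact: groupX.
    by have [z Gz <-] := G_pow y Gy; exists z.
  have /imset_injP inj_q : #|[set (y ^+ q)%g | y in G]| == #|G| by rewrite sqG.
  have Dx : x = 1%g by apply: inj_q; rewrite ?group1 // expg1n -ox expg_order.
  by have:= prime_gt1 q_prime; rewrite -ox Dx order1.
have d_gt0 : (0 < d)%N.
  have := f_irr.1; rewrite -(size_map_poly iota) Df size_prod_XsubC ltnS.
  by [].
have trG : orbit 'P G (Ordinal d_gt0) = [set: 'I_d].
  apply/setP=> i; rewrite inE; apply/orbitP.
  have [||sigma gal_s Ds] :=
    @galois_transitive _ _ iota L_galois f (rt (Ordinal d_gt0)) (rt i) f_irr.
  - by rewrite -root_s.
  - by rewrite -root_s.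
  have [pi a] := acts_ex _ gal_s; exists pi; first by apply/GamP; exists sigma.
  by apply: rt_inj; rewrite -a Ds.
have Dd : #|orbit 'P G (Ordinal d_gt0)| = d by rewrite trG cardsT card_ord.
by rewrite -Dd; apply: coprime_dvdr q'G; apply: dvdn_orbit.
Qed.

End ProcyclicGaloisGroup.

(** * Embeddings into division algebras *)

(** The orbit of [x] stays in [r], so it closes up after at most [m] steps. *)
Lemma iter_fact_fixed (T : eqType) (f : T -> T) (r : seq T) (m : nat) (x : T) :
  injective f -> (forall y, y \in r -> f y \in r) -> x \in r -> (size r <= m)%N ->
  iter m`! f x = x.
Proof.
move=> f_inj r_f r_x le_rm.
have r_iter i : iter i f x \in r by elim: i => //= i /r_f.
have: looping f x m.
  apply: contraLR le_rm; rewrite -looping_uniq -ltnNge => uniq_tr.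
  rewrite -[X in (X <= _)%N](size_traject f x); apply: uniq_leq_size => // y.
  by case/trajectP => i _ ->.
move=> /trajectP[i lt_im Di].
have [k Dm] : exists k, m = (k + i)%N by exists (m - i)%N; rewrite subnK // ltnW.
have k_gt0 : (0 < k)%N by move: lt_im; rewrite Dm -{1}[i]add0n ltn_add2r.
have fk : iter k f x = x.
  have iter_inj n : injective (iter n f) by elim: n => // n IHn a b /f_inj/IHn.
  by apply: (iter_inj i); rewrite -iterD addnC -Dm.
have /dvdnP[n ->]: (k %| m`!)%N.
  by apply: dvdn_fact; rewrite k_gt0 Dm leq_addr.
by elim: n => // n IHn; rewrite mulSn iterD IHn.
Qed.

Section CentralEmbedding.

Variables (F : fieldType) (E : falgType F).

(** The first [\dim E + 1] powers of [e] are linearly dependent. *)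
Lemma falg_algebraic (e : E) : exists c : {poly F},
  [/\ c != 0, (size c <= (\dim {:E}).+1)%N & horner_alg e c = 0].
Proof.
set m := \dim {:E}; pose X := [tuple e ^+ (val i) | i < m.+1].
have: ~~ free X.
  apply/negP; rewrite /free size_tuple => /eqP dimX.
  by have:= dimvS (subvf <<X>>%VS); rewrite dimX ltnn.
move/freeP => notX.
have [a aX [i ai]] : exists2 a : 'I_m.+1 -> F,
    \sum_(i < m.+1) a i *: X`_i = 0 & exists i, a i <> 0.
  apply: contrapT => nex; apply: notX => a aX i; apply: contrapT => ai.
  by apply: nex; exists a => //; exists i.
exists (\poly_(i < m.+1) a (inord i)); split; last 1 first.
- rewrite -aX poly_def rmorph_sum /=; apply: eq_bigr => j _.
  rewrite inord_val linearZ /= rmorphXn /= horner_algX.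
  by rewrite (nth_map ord0) ?size_enum_ord // nth_ord_enum mulr_algl.
- apply/eqP => /polyP/(_ i); rewrite coef_poly ltn_ord coef0 inord_val; exact: ai.
exact: size_poly.
Qed.

Hypothesis E_div : forall x : E, x != 0 -> x \is a GRing.unit.

Lemma div_mulf_eq0 (x y : E) : x * y = 0 -> x = 0 \/ y = 0.
Proof.
move=> xy0; have [-> | /E_div x_unit] := eqVneq x 0; [by left | right].
by apply: (mulrI x_unit); rewrite mulr0.
Qed.

Lemma rat_in_scalars (f : {rmorphism rat -> E}) k : exists c : F, f k = c%:A.
Proof.
have intE (z : int) : f z%:~R = (z%:~R : F)%:A by rewrite rmorph_int -scaler_int.
have d_neq0 : (denq k)%:~R != 0 :> F.
  apply: contra_neq (denq_neq0 k) => d0; apply/eqP.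
  by rewrite -(intr_eq0 rat) -(fmorph_eq0 f) intE d0 scale0r.
exists ((numq k)%:~R / (denq k)%:~R).
apply: (mulIr (E_div (x := f (denq k)%:~R) _)).
  by rewrite fmorph_eq0 intr_eq0 denq_neq0.
rewrite -rmorphM -{1}(divq_num_den k) divfK ?intr_eq0 ?denq_neq0 // !intE.
by rewrite -scalerAl mul1r scalerA divfK.
Qed.

Variables (L : fieldType) (j : {rmorphism L -> E}).

Lemma map_uniq_roots (s : seq L) : uniq s -> uniq_roots (map j s).
Proof.
elim: s => //= x s IHs /andP[s'x /IHs ->]; rewrite andbT; apply/allP => _ /mapP[y s_y ->].
rewrite /diff_roots -!rmorphM mulrC eqxx /= -rmorphB E_div // fmorph_eq0 subr_eq0.
by apply: contraNneq s'x => <-.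
Qed.

(** Inside [E], a polynomial over [F] killing [j x] has a common divisor [q] with a
   polynomial over the integers whose roots all lie in [L]. As the coefficients of
   [q] are central and the elements of [j L] commute, the roots of [q] in [j L]
   can be counted as over a field, and [q] is up to a constant the product of the
   ['X - j z] over its roots [z]: so its coefficients lie in [F] and in [j L]. *)
Lemma min_poly_descent (iota : {rmorphism rat -> L}) (x : L) :
    galois_extension iota -> exists r : seq L,
  [/\ x \in r, (size r <= \dim {:E})%N
    & forall i, exists c : F, j (\prod_(z <- r) ('X - z%:P))`_i = c%:A].
Proof.
move=> L_galois; have [p [s [_ _ Dp Us s_x]]] := galois_roots L_galois x.
have [pZ [a a_neq0 DpZ]] := rat_poly_scale p.
pose pF : {poly F} := map_poly intr pZ.
have DpL : map_poly intr pZ = a%:~R *: \prod_(z <- s) ('X - z%:P) :> {poly L}.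
  rewrite -Dp DpZ; apply/polyP=> i; rewrite coefZ !coef_map coefZ coef_map /=.
  rewrite rmorphM fmorphV !rmorph_int mulVKf // -(rmorph_int iota) fmorph_eq0.
  by rewrite intr_eq0.
have DpE : map_poly (in_alg E) pF = map_poly j (map_poly intr pZ).
  apply/polyP=> i; rewrite !coef_map /= rmorph_int -scaler_int.
  by rewrite scaler_int.
have aL_neq0 : a%:~R != 0 :> L.
  by rewrite -(rmorph_int iota) fmorph_eq0 intr_eq0.
have sz_pF : size pF = (size s).+1.
  rewrite -(size_map_poly (in_alg E)) DpE size_map_poly DpL size_scale //.
  by rewrite size_prod_XsubC.
have ev_pF z : z \in s -> horner_alg (j z) pF = 0.
  move=> s_z; rewrite /horner_alg /horner_morph DpE horner_map DpL hornerZ.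
  by rewrite (rootP _) ?mulr0 ?rmorph0 // root_prod_XsubC.
have [c [c_neq0 sz_c ev_c]] := falg_algebraic (j x).
pose q := gcdp pF c; pose r := pF %/ q.
have q_neq0 : q != 0 by rewrite gcdp_eq0 negb_and c_neq0 orbT.
have Drq : pF = r * q by rewrite divpK // dvdp_gcdl.
have ev_q : horner_alg (j x) q = 0.
  have [[u v] /= /eqpP[[k l] /= /andP[k0 l0] Duv]] := Bezoutp pF c.
  have:= congr1 (horner_alg (j x)) Duv.
  rewrite !linearZ /= rmorphD !rmorphM /= ev_c ev_pF // !mulr0 addr0 mulr0 mulr_algl.
  by move/esym/eqP; rewrite scaler_eq0 (negPf l0) => /eqP.
pose s1 := [seq z <- s | horner_alg (j z) q == 0].
pose s2 := [seq z <- s | horner_alg (j z) q != 0].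
have sz12 : (size s1 + size s2)%N = size s.
  by rewrite !size_filter count_predC.
have r_neq0 : r != 0.
  by apply/eqP => r0; have:= sz_pF; rewrite Drq r0 mul0r size_poly0.
have qE_roots : all (root (map_poly (in_alg E) q)) (map j s1).
  by apply/allP => y /mapP[z]; rewrite mem_filter => /andP[qz _] ->.
have rE_roots : all (root (map_poly (in_alg E) r)) (map j s2).
  apply/allP => y /mapP[z]; rewrite mem_filter => /andP[qz s_z] ->; apply/rootP.
  have:= ev_pF z s_z; rewrite Drq rmorphM => /div_mulf_eq0[] // /eqP.
  by rewrite (negPf qz).
have lt1 : (size s1 < size q)%N.
  rewrite -(size_map_poly (in_alg E)) -(size_map j) max_ring_poly_roots //.
    by rewrite map_poly_eq0.
  by rewrite map_uniq_roots ?filter_uniq.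
have lt2 : (size s2 < size r)%N.
  rewrite -(size_map_poly (in_alg E)) -(size_map j) max_ring_poly_roots //.
    by rewrite map_poly_eq0.
  by rewrite map_uniq_roots ?filter_uniq.
(* The roots of p are shared between q and its cofactor r, neither of which has
   more roots than its degree; as the degrees add up, both bounds are attained. *)
have sz_q : size q = (size s1).+1.
  have:= sz_pF; rewrite Drq size_mul // -sz12 => Dsz.
  apply/eqP; rewrite eqn_leq lt1 andbT -(leq_add2l (size s2).+1).
  apply: leq_trans (leq_add lt2 (leqnn _)) _.
  rewrite -[X in (X <= _)%N]prednK ?addn_gt0 ?(leq_ltn_trans _ lt2) //.
  by rewrite Dsz addSn addnS addnC.
exists s1; split.
- by rewrite mem_filter ev_q eqxx.
- by rewrite -ltnS -sz_q (leq_trans _ sz_c) // dvdp_leq // dvdp_gcdr.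
move=> i; exists ((lead_coef q)^-1 * q`_i).
have DqE : map_poly (in_alg E) q =
    lead_coef (map_poly (in_alg E) q) *: map_poly j (\prod_(z <- s1) ('X - z%:P)).
  rewrite rmorph_prod; under eq_bigr do rewrite rmorphB /= map_polyX map_polyC /=.
  rewrite -(big_map j xpredT (fun z => 'X - z%:P)) -all_roots_prod_XsubC //.
    by rewrite size_map size_map_poly.
  by rewrite map_uniq_roots ?filter_uniq.
have /= := congr1 (fun g : {poly E} => g`_i) DqE.
rewrite coefZ lead_coef_map !coef_map /= => DqEi.
rewrite -scalerA DqEi -scalerAl mul1r scalerA mulVf ?scale1r //.
by rewrite lead_coef_eq0.
Qed.

(** An automorphism fixing the preimage of [F] permutes the at most [\dim E]
   conjugates of each [y] given by [min_poly_descent], so it has finite order and is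
   the identity. *)
Lemma procyclic_embeds_centrally (iota : {rmorphism rat -> L}) p : prime p ->
    galois_extension iota -> galois_group_iso_Zp iota p ->
  forall x, exists c : F, j x = c%:A.
Proof.
move=> p_prime L_galois gal_Zp x.
pose F0 := [set y : L | exists c : F, j y = c%:A]%classic.
suffices: F0 x by [].
apply: (fixed_field L_galois).
- by move=> k; apply: (rat_in_scalars (j \o iota)).
- by move=> a b [c Da] [d Db]; exists (c - d); rewrite rmorphB Da Db scalerBl.
- move=> a b [c Da] [d Db]; exists (c * d).
  by rewrite rmorphM Da Db -scalerAl mul1r scalerA.
move=> sigma gal_s fix_s.
apply: (galois_torsionfree p_prime gal_Zp (fact_gt0 (\dim {:E})) gal_s) => y.
have [_ _ /bij_inj s_inj _] := gal_s.
have [r [r_y sz_r r_F]] := min_poly_descent y L_galois.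
apply: (iter_fact_fixed s_inj _ r_y sz_r) => z.
have [f Df] := galois_rmorphism gal_s.
rewrite -!root_prod_XsubC => /rootP rz; apply/rootP; set P := \prod_(z <- r) _.
have DP : P = map_poly f P by apply/polyP=> i; rewrite coef_map /= Df fix_s //; apply: r_F.
by rewrite DP -Df horner_map rz rmorph0.
Qed.

End CentralEmbedding.

(** * Scalar extensions and split algebras *)

Section ScalarExtension.

Variables (K L : fieldType) (iota : {rmorphism K -> L}).
Variables (A : falgType K) (T : algType L) (t : A -> L -> T).
Hypothesis tensor_t : is_scalar_extension iota t.

Let n := \dim {:A}.
Let e : n.-tuple A := vbasis {:A}.

Lemma tensorDl a b x : t (a + b) x = t a x + t b x.
Proof. by have [-> _ _] := tensor_balanced tensor_t. Qed.

Lemma tensorDr a x y : t a (x + y) = t a x + t a y.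
Proof. by have [_ -> _] := tensor_balanced tensor_t. Qed.

Lemma tensorZ k a x : t (k *: a) x = t a (iota k * x).
Proof. by have [_ _ ->] := tensor_balanced tensor_t. Qed.

Lemma tensor0l x : t 0 x = 0.
Proof. by apply: (addrI (t 0 x)); rewrite -tensorDl !addr0. Qed.

Lemma tensor0r a : t a 0 = 0.
Proof. by apply: (addrI (t a 0)); rewrite -tensorDr !addr0. Qed.

Lemma tensorNl a x : t (- a) x = - t a x.
Proof. by apply: (addrI (t a x)); rewrite -tensorDl !subrr tensor0l. Qed.

Lemma tensor_suml m (F : 'I_m -> A) x : t (\sum_i F i) x = \sum_i t (F i) x.
Proof. exact: (big_morph (t^~ x) (fun a b => tensorDl a b x) (tensor0l x)). Qed.

Lemma tensor_sumr m (F : 'I_m -> L) a : t a (\sum_i F i) = \sum_i t a (F i).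
Proof. exact: (big_morph (t a) (tensorDr a) (tensor0r a)). Qed.

Lemma tensor11 : t 1 1 = 1.
Proof. by rewrite (tensor_scalar tensor_t) scale1r. Qed.

(** The coordinates of [a] in a basis of [A] are balanced, which makes them
   coordinates over [L] on the tensor product. *)
Lemma tensor_coordinates : exists g : {additive T -> 'rV[L]_n},
  forall a x, g (t a x) = \row_i (iota (coord e i a) * x).
Proof.
apply: (tensor_lift tensor_t); split=> [a b x | a x y | k a x]; apply/rowP=> i.
- by rewrite !mxE linearD rmorphD mulrDl.
- by rewrite !mxE mulrDr.
by rewrite !mxE linearZ rmorphM mulrA [iota k * _]mulrC.
Qed.

(** Recomposing a tensor from its coordinates is an additive map that is the identity
   on pure tensors, hence the identity. *)
Lemma tensor_span u : exists x : 'I_n -> L, u = \sum_(i < n) t e`_i (x i).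
Proof.
have [g gt] := tensor_coordinates.
pose f (v : T) : T := \sum_(i < n) t e`_i (g v 0 i).
have f_sub : zmod_morphism f.
  move=> v w; rewrite /f -sumrB; apply: eq_bigr => i _.
  rewrite raddfB !mxE; apply/eqP; rewrite eq_sym subr_eq -tensorDr subrK.
  by [].
pose fA := HB.pack_for {additive T -> T} f (GRing.isZmodMorphism.Build T T f f_sub).
exists (fun i => g u 0 i); apply/esym.
apply: (tensor_unique tensor_t (g1 := fA) (g2 := idfun)) => a x /=.
rewrite /f gt; under eq_bigr do rewrite mxE -tensorZ.
by rewrite -tensor_suml -(coord_vbasis (memvf a)).
Qed.

Definition lin_indep (m : nat) (x : 'I_m -> L) : Prop :=
  forall c : 'I_m -> K, \sum_i iota (c i) * x i = 0 -> forall i, c i = 0.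

Lemma tensor_indep m (a : 'I_m -> A) (x : 'I_m -> L) : lin_indep x ->
  \sum_i t (a i) (x i) = 0 -> forall i, a i = 0.
Proof.
move=> x_indep ax0 i; have [g gt] := tensor_coordinates.
rewrite (coord_vbasis (memvf (a i))) big1 // => l _.
rewrite (x_indep (fun j => coord e l (a j)) _ i) ?scale0r //.
have gl : g (\sum_j t (a j) (x j)) 0 l = 0 by rewrite ax0 raddf0 mxE.
rewrite -[RHS]gl raddf_sum summxE; apply: eq_bigr => j _.
by rewrite gt mxE.
Qed.

End ScalarExtension.

Section SplitSubalgebra.

Variables (K L : fieldType) (iota : {rmorphism K -> L}) (A : falgType K).
Hypotheses (A_central : 'Z({:A})%VS = 1%VS) (A_nontrivial : (1 < \dim {:A})%N).

(** A nonzero nilpotent matrix generates the unit ideal, so that its image in [R] is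
   a nonzero nilpotent. *)
Lemma split_image_nilpotent (R : nzRingType) (f : {rmorphism A -> R})
    (j : {rmorphism L -> R}) :
    split_by iota A -> (forall k, f k%:A = j (iota k)) ->
    (forall x r, j x * r = r * j x) ->
  exists2 u : R, u != 0 & u * u = 0.
Proof.
move=> [T [t [ht [n [h h_bij]]]]] f_base j_central.
have [g gt] : exists g : {additive T -> R}, forall a x, g (t a x) = f a * j x.
  apply: (tensor_lift ht); split=> [a b x | a x y | k a x].
  - by rewrite rmorphD mulrDl.
  - by rewrite rmorphD mulrDr.
  by rewrite -mulr_algl !rmorphM f_base -mulrA j_central -!mulrA j_central.
have gM u v : g (u * v) = g u * g v.
  have [x ->] := tensor_span ht u; have [y ->] := tensor_span ht v.
  rewrite mulr_suml !raddf_sum mulr_suml; apply: eq_bigr => i _.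
  rewrite mulr_sumr !raddf_sum mulr_sumr; apply: eq_bigr => k _.
  rewrite (tensor_mul ht) !gt !rmorphM -!mulrA; congr (_ * _).
  by rewrite !mulrA j_central.
have g1 : g 1 = 1 by rewrite -(tensor11 ht) gt !rmorph1 mulr1.
(* If n.+1 = 1 then A is commutative, so equal to its center, which has
   dimension one. *)
have n_gt0 : (0 < n)%N.
  rewrite lt0n; apply/eqP => n0; subst n.
  have T_comm (u v : T) : u * v = v * u.
    apply: (bij_inj h_bij); rewrite !rmorphM; apply/matrixP => i k.
    by rewrite !ord1 !mxE !big_ord1 mulrC.
  have A_comm (a b : A) : a * b = b * a.
    apply/eqP; rewrite -subr_eq0; apply/eqP.
    have x_indep : lin_indep iota (fun _ : 'I_1 => 1 : L).
      move=> c; rewrite big_ord1 mulr1 => /eqP; rewrite fmorph_eq0 => /eqP c0 i.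
      by rewrite ord1.
    apply: (tensor_indep ht x_indep (a := fun _ => a * b - b * a) _ ord0).
    rewrite big_ord1 (tensorDl ht) (tensorNl ht).
    by rewrite -[1]mulr1 -!(tensor_mul ht) T_comm subrr.
  have : (fullv <= 'Z({:A}))%VS.
    by rewrite subv_cap subvf; apply/centvsP => a b _ _.
  rewrite A_central => /dimvS; rewrite dimv1 leqNgt => /negP; apply.
  exact: A_nontrivial.
pose k1 : 'I_n.+1 := Ordinal (n_gt0 : (1 < n.+1)%N).
have [h' hK h'K] := h_bij.
pose E i k := h' (delta_mx i k : 'M[L]_n.+1).
have EM i k m : E i k * E k m = E i m.
  by apply: (bij_inj h_bij); rewrite rmorphM /= !h'K -[_ * _]/(_ *m _) mul_delta_mx.
exists (g (E 0 k1)).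
  apply/eqP=> gE0; have /eqP := g1.
  have -> : 1 = \sum_i E i 0 * E 0 k1 * E k1 i.
    apply: (bij_inj h_bij); rewrite rmorph1 rmorph_sum /=.
    under eq_bigr do rewrite !EM h'K.
    exact: mx1_sum_delta.
  rewrite raddf_sum big1 => [|i _]; first by rewrite eq_sym oner_eq0.
  by rewrite !gM gE0 mulr0 mul0r.
rewrite -gM; have -> : E 0 k1 * E 0 k1 = 0.
  apply: (bij_inj h_bij); rewrite rmorphM rmorph0 /= !h'K -[_ * _]/(_ *m _).
  by rewrite mul_delta_mx_0.
by rewrite raddf0.
Qed.

End SplitSubalgebra.

(** * Dimension of modules over a division algebra *)

Section LinearAlgebra.

Variable K : fieldType.

(** A subspace of maximal dimension among those included in [P] is all of [P]. *)
Lemma linear_subset_vspace (W : vectType K) (P : W -> Prop) :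
    P 0 -> (forall k v w, P v -> P w -> P (k *: v + w)) ->
  exists U : {vspace W}, forall w, w \in U <-> P w.
Proof.
move=> P0 Plin; pose inP (U : {vspace W}) := forall w, w \in U -> P w.
pose Q m := `[< exists2 U, inP U & \dim U = m >].
have exQ : exists m, Q m.
  exists 0%N; apply/asboolP; exists 0%VS; last exact: dimv0.
  by move=> w; rewrite memv0 => /eqP->.
have ubQ m : Q m -> (m <= \dim {:W})%N.
  by move=> /asboolP[U _ <-]; rewrite dimvS ?subvf.
case: (ex_maxnP exQ ubQ) => m /asboolP[U UP <-] maxU.
exists U => w; split=> [/UP // | Pw].
have /maxU : Q (\dim (U + <[w]>)).
  apply/asboolP; exists (U + <[w]>)%VS => // _ /memv_addP[u Uu [_ /vlineP[k ->] ->]].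
  by rewrite addrC; apply: Plin => //; apply: UP.
move=> dimUw; have /eqP-> : U == (U + <[w]>)%VS by rewrite eqEdim addvSl dimUw.
by rewrite (subvP (addvSr _ _)) ?memv_line.
Qed.

(** [rho] makes [W] a module over a finite dimensional algebra without zero divisors,
   recorded only through its underlying space [A] and the operators it induces.
   Submodules of such a module are free: as long as [V] is not all of [U], a vector
   [v] of [U] outside of [V] enlarges [V] by the direct summand [A v]. *)
Lemma dim_submodule (A W : vectType K) (rho : A -> W -> W) (U : {vspace W}) :
    (forall w, linear (rho^~ w)) -> (forall a, linear (rho a)) ->
    (forall a w, a != 0 -> rho a w = 0 -> w = 0) ->
    (forall a b, exists c, forall w, rho a (rho b w) = rho c w) ->
    (exists a, forall w, rho a w = w) ->
    (forall a w, w \in U -> rho a w \in U) ->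
  (\dim {:A} %| \dim U)%N.
Proof.
move=> linl linr rho_inj rho_comp [a1 rho1] U_stable.
pose stable (V : {vspace W}) := forall a w, w \in V -> rho a w \in V.
have linfunl w : exists f : 'Hom(A, W), forall a, f a = rho a w.
  pose f := HB.pack_for {linear A -> W} (rho^~ w)
    (GRing.isLinear.Build K A W *:%R _ (linl w)).
  by exists (linfun f) => a; rewrite lfunE.
have linfunr a : exists f : 'End(W), forall w, f w = rho a w.
  pose f := HB.pack_for {linear W -> W} (rho a)
    (GRing.isLinear.Build K W W *:%R _ (linr a)).
  by exists (linfun f) => w; rewrite lfunE.
suffices IH k V : (\dim U - \dim V < k)%N -> (V <= U)%VS -> stable V ->
    (\dim {:A} %| \dim V)%N -> (\dim {:A} %| \dim U)%N.
  apply: (IH _ 0%VS (ltnSn _)); rewrite ?sub0v ?dimv0 ?dvdn0 // => a w.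
  rewrite !memv0 => /eqP->; have [f fE] := linfunr a.
  by rewrite -fE linear0.
elim: k V => // k IHk V lt_k sVU V_stable dvdV.
have [sUV | /subvPn[v Uv V'v]] := boolP (U <= V)%VS.
  by have <- : V = U by apply/eqP; rewrite eqEsubv sVU.
have [f fE] := linfunl v.
have f0 : lker f = 0%VS.
  apply/eqP; rewrite -subv0; apply/subvP => a; rewrite memv_ker memv0 fE.
  apply: contraTT => a0; apply: contraNneq V'v => /rho_inj-> //; exact: mem0v.
have dimf : \dim (limg f) = \dim {:A} by rewrite limg_dim_eq // f0 capv0.
have capVf : (V :&: limg f = 0)%VS.
  apply/eqP; rewrite -subv0; apply/subvP => w0 /memv_capP[Vw /memv_imgP[a _ Dw0]].
  move: Vw; rewrite memv0 Dw0 fE => Vw.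
  have [-> | a0] := eqVneq a 0; first by rewrite -fE linear0.
  (* On the stable space V the injective operator rho a is onto, so that
     rho a v = rho a w with w in V, whence v = w. *)
  have [h hE] := linfunr a.
  have hV : (h @: V = V)%VS.
    apply/eqP; rewrite eqEdim; apply/andP; split.
      by apply/subvP => _ /memv_imgP[w Vw' ->]; rewrite hE V_stable.
    rewrite limg_dim_eq //; apply/eqP; rewrite -subv0; apply/subvP => w.
    by rewrite memv_cap memv_ker hE memv0 => /andP[_ /eqP/rho_inj->].
  move: Vw; rewrite -{1}hV => /memv_imgP[w Vw Dw].
  case/negP: V'v; rewrite (_ : v = w) //; apply/subr0_eq/(rho_inj a) => //.
  by rewrite -hE linearB /= hE Dw subrr.
have dimVf : \dim (V + limg f) = (\dim V + \dim {:A})%N.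
  by rewrite dimv_disjoint_sum // dimf.
have V_v : v \in (V + limg f)%VS.
  by apply: (subvP (addvSr _ _)); rewrite -[v]rho1 -fE memv_img ?memvf.
have sVfU : (V + limg f <= U)%VS.
  rewrite subv_add sVU; apply/subvP => _ /memv_imgP[a _ ->].
  by rewrite fE U_stable.
apply: (IHk (V + limg f)%VS) => //.
- apply: leq_trans (_ : (\dim U - \dim V)%N <= _)%N; last by rewrite -ltnS.
  apply: ltn_sub2l; last first.
    rewrite ltn_neqAle dimvS ?addvSl // andbT; apply: contraNneq V'v => Ddim.
    suff -> : V = (V + limg f)%VS by [].
    by apply/eqP; rewrite eqEdim addvSl -Ddim leqnn.
  rewrite ltnNge; apply: contraNN V'v => le_UV.
  by rewrite (_ : V = U) //; apply/eqP; rewrite eqEdim sVU.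
- move=> a _ /memv_addP[x Vx [_ /memv_imgP[b _ ->] ->]].
  have [h hE] := linfunr a; rewrite -hE linearD /= !hE fE.
  apply: memv_add; first exact: V_stable.
  by have [c ->] := rho_comp a b; rewrite -fE memv_img ?memvf.
by rewrite dimVf dvdn_addr.
Qed.

End LinearAlgebra.

(** * Scalar extensions of division algebras *)

Section PrimitiveElement.

Variables (K L : fieldType) (iota : {rmorphism K -> L}).
Hypotheses (L_galois : galois_extension iota) (K_char0 : has_char0 K).

Lemma galois_primitive_element (m : nat) (x : 'I_m -> L) : exists theta : L,
  forall i, exists f : {poly K}, x i = (map_poly iota f).[theta].
Proof.
elim: m x => [|m IHm] x; first by exists 0 => -[].
have [th1 th1P] := IHm (fun i => x (lift ord0 i)).
have [p1 [s1 [p1_irr _ Dp1 _ s_th1]]] := galois_roots L_galois th1.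
have [p0 [s0 [p0_irr _ Dp0 _ s_x0]]] := galois_roots L_galois (x ord0).
have x0_root : root (map_poly iota p0) (x ord0) by rewrite Dp0 root_prod_XsubC.
have th1_root : root (map_poly iota p1) th1 by rewrite Dp1 root_prod_XsubC.
have [n [[f0 Df0] [f1 Df1]]] :=
  pchar0_PET (irredp_neq0 p0_irr) x0_root (irredp_neq0 p1_irr) th1_root K_char0.
exists (th1 *+ n - x ord0) => i; case: (unliftP ord0 i) => [k ->| ->]; last by exists f0.
have [f Df] := th1P k; exists (f \Po f1).
by rewrite map_comp_poly horner_comp Df1 -Df.
Qed.

End PrimitiveElement.

Section DivisionExtension.

Variables (K L : fieldType) (iota : {rmorphism K -> L}).
Variables (D : falgType K) (T : algType L) (t : D -> L -> T).
Hypothesis tensor_t : is_scalar_extension iota t.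
Hypothesis D_div : forall x : D, x != 0 -> x \is a GRing.unit.

Variables (theta : L) (p : {poly K}).
Hypotheses (p_irr : irreducible_poly p) (p_theta : root (map_poly iota p) theta).

Let d := (size p).-1.
Let W : vectType K := {ffun 'I_d -> D}.
Let ev (f : {poly K}) : L := (map_poly iota f).[theta].

Let size_p : size p = d.+1.
Proof. by rewrite prednK // (leq_trans _ p_irr.1). Qed.

Let d_gt0 : (0 < d)%N.
Proof. by rewrite -ltnS -size_p p_irr.1. Qed.

Let evM f g : ev (f * g) = ev f * ev g.
Proof. by rewrite /ev rmorphM hornerM. Qed.

Lemma eval_modp f : ev (f %% p) = ev f.
Proof.
rewrite {2}(divp_eq f p) /ev rmorphD rmorphM /= hornerD hornerM (rootP p_theta).
by rewrite mulr0 add0r.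
Qed.

Lemma size_modp_min f : (size (f %% p)%R <= d)%N.
Proof. by rewrite -ltnS -size_p ltn_modp irredp_neq0. Qed.

Lemma eval_expand f : ev f = \sum_(k < d) iota (f %% p)`_k * theta ^+ k.
Proof.
rewrite -eval_modp /ev (horner_coef_wide _ (n := d)); last first.
  by rewrite size_map_poly size_modp_min.
by apply: eq_bigr => k _; rewrite coef_map.
Qed.

Lemma eval_eq0 (f : {poly K}) : (size f <= d)%N -> ev f = 0 -> f = 0.
Proof.
move=> sz_f /rootP/(irreducible_dvdp_root p_irr p_theta) p_f.
apply: contraTeq p_f => f0; apply: contraTN sz_f => /(dvdp_leq f0).
by rewrite size_p ltnNge.
Qed.

Lemma powers_indep : lin_indep iota (fun i : 'I_d => theta ^+ i).
Proof.
move=> c; have -> : \sum_(i < d) iota (c i) * theta ^+ i = ev (rVpoly (\row_i c i)).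
  rewrite eval_expand modp_small; last by rewrite size_p ltnS size_poly.
  by apply: eq_bigr => i _; rewrite coef_rVpoly_ord mxE.
move=> ev0; have c0 : rVpoly (\row_i c i) = 0 by apply: eval_eq0 ev0; apply: size_poly.
move=> i.
by have := coef_rVpoly_ord (\row_i c i) i; rewrite c0 coef0 mxE.
Qed.

(** [W] and [power_sum] describe [D (x) K(theta)] as a space over [K], in the basis
   of the powers of [theta]. *)
Definition power_sum (w : W) : T := \sum_(j < d) t (w j) (theta ^+ j).

Lemma power_sum_linear k v w :
  power_sum (k *: v + w) = t 1 (iota k) * power_sum v + power_sum w.
Proof.
rewrite /power_sum mulr_sumr -big_split; apply: eq_bigr => j _ /=.
by rewrite !ffunE (tensorDl tensor_t) (tensorZ tensor_t) (tensor_mul tensor_t) mul1r.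
Qed.

Lemma power_sum0 : power_sum 0 = 0.
Proof.
by rewrite /power_sum big1 // => j _; rewrite ffunE (tensor0l tensor_t).
Qed.

Lemma power_sum_inj v w : power_sum v = power_sum w -> v = w.
Proof.
move=> Dvw; apply/ffunP=> j; apply/eqP; rewrite -subr_eq0; apply/eqP.
apply: (tensor_indep tensor_t powers_indep (a := fun j => v j - w j)).
under eq_bigr do rewrite (tensorDl tensor_t) (tensorNl tensor_t).
by rewrite sumrB -/(power_sum v) -/(power_sum w) Dvw subrr.
Qed.

Lemma power_sum_span n (a : 'I_n -> D) (f : 'I_n -> {poly K}) :
  exists w, \sum_i t (a i) (ev (f i)) = power_sum w.
Proof.
exists [ffun k : 'I_d => \sum_i (f i %% p)`_k *: a i].
rewrite /power_sum; under [RHS]eq_bigr do rewrite ffunE (tensor_suml tensor_t).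
rewrite exchange_big; apply: eq_bigr => i _ /=.
rewrite eval_expand (tensor_sumr tensor_t); apply: eq_bigr => k _.
by rewrite (tensorZ tensor_t).
Qed.

Definition left_mul (a : D) (w : W) : W := [ffun j => a * w j].

Lemma power_sum_left_mul a w : power_sum (left_mul a w) = t a 1 * power_sum w.
Proof.
rewrite /power_sum mulr_sumr; apply: eq_bigr => j _.
by rewrite ffunE (tensor_mul tensor_t) mul1r.
Qed.

(** Multiplication by the element of [K(theta)] with coordinates [c]: products of
   powers of [theta] are reduced modulo the minimal polynomial [p]. *)
Definition theta_mul (c : 'rV[K]_d) (w : W) : W :=
  [ffun k : 'I_d => \sum_(l < d) ((rVpoly c * 'X^l) %% p)`_k *: w l].

Lemma power_sum_theta_mul c w :
  power_sum (theta_mul c w) = t 1 (ev (rVpoly c)) * power_sum w.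
Proof.
rewrite /power_sum; under eq_bigr do rewrite ffunE (tensor_suml tensor_t).
rewrite exchange_big mulr_sumr; apply: eq_bigr => l _ /=.
rewrite (tensor_mul tensor_t) mul1r.
have -> : ev (rVpoly c) * theta ^+ l = ev (rVpoly c * 'X^l).
  by rewrite evM; congr (_ * _); rewrite /ev map_polyXn hornerXn.
rewrite eval_expand (tensor_sumr tensor_t); apply: eq_bigr => k _.
by rewrite (tensorZ tensor_t).
Qed.

Lemma power_sum1 : exists w, power_sum w = 1.
Proof.
have [w Dw] := power_sum_span (fun _ : 'I_1 => 1) (fun _ => 1).
by exists w; rewrite -Dw big_ord1 /ev rmorph1 hornerC (tensor11 tensor_t).
Qed.

(** The left annihilator of [u] in [D (x) K(theta)] is a module both over [D] and
   over [K(theta)]. As their dimensions are coprime, its dimension is a multiple of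
   that of [D (x) K(theta)]; and if it is everything, it contains [1]. *)
Lemma power_sum_annihilator (w : W) (u : T) :
  coprime (\dim {:D}) d -> power_sum w * u = 0 -> w = 0 \/ u = 0.
Proof.
move=> co_nd; pose P v := power_sum v * u = 0.
have [||J JP] := @linear_subset_vspace K W P.
- by rewrite /P power_sum0 mul0r.
- by move=> k v v' Pv Pv'; rewrite /P power_sum_linear mulrDl -mulrA Pv Pv' mulr0 addr0.
move=> /JP Jw.
have dvdD : (\dim {:D} %| \dim J)%N.
  apply: (@dim_submodule K D W left_mul).
  - by move=> v k a b; apply/ffunP=> j; rewrite !ffunE mulrDl scalerAl.
  - by move=> a k v v'; apply/ffunP=> j; rewrite !ffunE mulrDr scalerAr.
  - move=> a v /D_div a_unit /ffunP av0; apply/ffunP=> j.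
    by apply: (mulrI a_unit); have := av0 j; rewrite !ffunE mulr0.
  - by move=> a b; exists (a * b) => v; apply/ffunP=> j; rewrite !ffunE mulrA.
  - by exists 1 => v; apply/ffunP=> j; rewrite ffunE mul1r.
  by move=> a v /JP Pv; apply/JP; rewrite /P power_sum_left_mul -mulrA Pv mulr0.
have dvdd : (d %| \dim J)%N.
  have -> : d = \dim {: 'rV[K]_d} by rewrite dimvf /dim /= mul1n.
  apply: (@dim_submodule K _ W theta_mul).
  - move=> v k a b; apply: power_sum_inj.
    rewrite power_sum_linear !power_sum_theta_mul mulrA -mulrDl.
    rewrite (tensor_mul tensor_t) mul1r -(tensorDr tensor_t).
    by rewrite /ev linearP rmorphD /= map_polyZ hornerD hornerZ.
  - move=> c k v v'; apply: power_sum_inj.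
    rewrite !power_sum_linear !power_sum_theta_mul power_sum_linear mulrDr !mulrA.
    by rewrite !(tensor_mul tensor_t) [ev _ * _]mulrC.
  - move=> c v c0 cv0; apply: power_sum_inj; rewrite power_sum0.
    have ev_c0 : ev (rVpoly c) != 0.
      apply: contra_neq c0 => ev0; rewrite -[c]rVpolyK.
      by rewrite (_ : rVpoly c = 0) ?linear0 //; apply: eval_eq0 ev0; apply: size_poly.
    have := power_sum_theta_mul c v; rewrite cv0 power_sum0 => /esym cv.
    rewrite -[LHS]mul1r -(tensor11 tensor_t) -(mulVf ev_c0) -[X in t X]mulr1.
    by rewrite -(tensor_mul tensor_t) -mulrA cv mulr0.
  - move=> c c'; exists (poly_rV ((rVpoly c * rVpoly c') %% p)) => v.
    apply: power_sum_inj; rewrite !power_sum_theta_mul mulrA.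
    by rewrite (tensor_mul tensor_t) mul1r poly_rV_K ?size_modp_min // eval_modp evM.
  - exists (poly_rV 1) => v; apply: power_sum_inj; rewrite power_sum_theta_mul.
    by rewrite poly_rV_K ?size_poly1 // /ev rmorph1 hornerC (tensor11 tensor_t) mul1r.
  move=> c v /JP Pv; apply/JP.
  by rewrite /P power_sum_theta_mul -mulrA Pv mulr0.
have dimW : \dim {:W} = (d * \dim {:D})%N.
  by rewrite dimvf /dim /= card_ord -dimvf.
have [J0 | J_neq0] := eqVneq J 0%VS.
  by left; apply/eqP; rewrite -memv0 -J0.
right; have JW : J = fullv.
  apply/eqP; rewrite eqEdim subvf /= dimW dvdn_leq //.
    by rewrite lt0n dimv_eq0.
  by rewrite mulnC Gauss_dvd // dvdD.
have [w1 Dw1] := power_sum1.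
have /JP : w1 \in J by rewrite JW memvf.
by rewrite /P Dw1 mul1r.
Qed.

(** Comparing coefficients of the powers of [theta] reduces centrality in
   [D (x) K(theta)] to centrality in [D]. *)
Lemma power_sum_central (w : W) : 'Z({:D})%VS = 1%VS ->
  (forall b, t b 1 * power_sum w = power_sum w * t b 1) ->
  exists x, power_sum w = t 1 x.
Proof.
move=> D_central w_comm.
have /choice[c wc] : forall j, exists c : K, w j = c%:A.
  move=> j; have : w j \in 'Z({:D})%VS.
    rewrite memv_cap memvf; apply/centvP => b _.
    have : left_mul b w = [ffun k => w k * b].
      apply: power_sum_inj; rewrite power_sum_left_mul w_comm.
      rewrite /power_sum mulr_suml; apply: eq_bigr => k _.
      by rewrite ffunE (tensor_mul tensor_t) mulr1.
    by move/ffunP/(_ j); rewrite !ffunE.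
  by rewrite D_central => /vlineP[c ->]; exists c.
exists (\sum_(j < d) iota (c j) * theta ^+ j); rewrite (tensor_sumr tensor_t).
by apply: eq_bigr => j _; rewrite wc (tensorZ tensor_t).
Qed.

End DivisionExtension.

(** Right multiplication by [x != 0] is injective, hence onto in finite dimension;
   this gives a left inverse, which is two-sided as there are no zero divisors. *)
Lemma domain_units (F : fieldType) (T : falgType F) :
  (forall x y : T, x * y = 0 -> x = 0 \/ y = 0) ->
  forall x : T, x != 0 -> x \is a GRing.unit.
Proof.
move=> T_dom.
have linv x : x != 0 -> exists y : T, y * x = 1.
  move=> x0; have /lker0_limgf img : lker (amulr x) == 0%VS.
    rewrite -subv0; apply/subvP => y; rewrite memv_ker memv0 lfunE /= => /eqP/T_dom[-> //|].
    by move/eqP; rewrite (negPf x0).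
  have : 1 \in limg (amulr x) by rewrite img memvf.
  by case/memv_imgP => y _ ->; exists y; rewrite lfunE.
move=> x x0; have [y yx] := linv x x0.
apply/unitrP; exists y; split=> //; apply/eqP; rewrite -subr_eq0; apply/eqP.
have := T_dom (x * y - 1) x; rewrite mulrBl -mulrA yx mulr1 mul1r subrr.
by move=> /(_ erefl)[// | /eqP]; rewrite (negPf x0).
Qed.

(** By the primitive element theorem each element of [D (x) L] lies in some
   [D (x) K(theta)], where both zero divisors and centrality are understood. *)
Lemma scalar_extension_division (K L : fieldType) (iota : {rmorphism K -> L})
    (D : falgType K) (T : falgType L) (t : D -> L -> T) :
    galois_extension iota -> has_char0 K -> division_algebra D ->
    is_scalar_extension iota t ->
    (forall (p : {poly K}) (theta : L), irreducible_poly p ->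
       root (map_poly iota p) theta -> coprime (\dim {:D}) (size p).-1) ->
  division_algebra T.
Proof.
move=> L_galois K_char0 [D_div D_central] tensor_t co_deg.
have in_power_sum (u : T) : exists (theta : L) (p : {poly K}) w,
  [/\ irreducible_poly p, root (map_poly iota p) theta
    & u = @power_sum K L D T t theta p w].
  have [x ->] := tensor_span tensor_t u.
  have [theta thetaP] := galois_primitive_element L_galois K_char0 x.
  have [f fP] := choice thetaP.
  have [p [s [p_irr _ Dp _ s_theta]]] := galois_roots L_galois theta.
  have p_theta : root (map_poly iota p) theta by rewrite Dp root_prod_XsubC.
  have [w Dw] := power_sum_span tensor_t p_irr p_theta
     (fun i : 'I_(\dim {:D}) => (vbasis {:D})`_i) f.
  exists theta, p, w; split=> //; rewrite -Dw.
  by apply: eq_bigr => i _; rewrite fP.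
split.
  apply: domain_units => u v; have [theta [p [w [p_irr p_theta ->]]]] := in_power_sum u.
  have co := co_deg p theta p_irr p_theta.
  move/(power_sum_annihilator tensor_t D_div p_irr p_theta co) => [-> | ->]; last by right.
  by left; rewrite (power_sum0 tensor_t).
apply/eqP; rewrite eqEsubv; apply/andP; split; last first.
  rewrite subv_cap subvf; apply/centvsP => _ v /vlineP[c ->] _.
  by rewrite mulr_algl mulr_algr.
apply/subvP => u; rewrite memv_cap => /andP[_ /centvP u_comm].
have [theta [p [w [p_irr p_theta Du]]]] := in_power_sum u.
have [|x Dx] := power_sum_central tensor_t p_irr p_theta (w := w) D_central.
  by move=> b; rewrite -Du u_comm ?memvf.
rewrite Du Dx (tensor_scalar tensor_t); by rewrite memvZ ?memv_line.
Qed.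

(** * The theorem *)

Lemma rat_rmorphism_uniq (R : nzRingType) (f g : {rmorphism rat -> R}) : f =1 g.
Proof.
move=> k; have d_neq0 : (denq k)%:~R != 0 :> rat by rewrite intr_eq0 denq_neq0.
have fg_int (z : int) : f z%:~R = g z%:~R by rewrite !rmorph_int.
have Dk : k * (denq k)%:~R = (numq k)%:~R by rewrite -{1}(divq_num_den k) divfK.
rewrite -[k in LHS](mulfK d_neq0) Dk rmorphM fg_int -Dk rmorphM -fg_int -mulrA.
by rewrite -rmorphM mulfV // rmorph1 mulr1.
Qed.

Theorem proposition1p1
  (p1 p2 : nat) (p1_prime : prime p1) (p2_prime : prime p2) (p1_neq_p2 : p1 <> p2)
  (F1 : fieldType) (iota : {rmorphism rat -> F1})
  (F1_galois : galois_extension iota)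
  (F1_group : galois_group_iso_Zp iota p2)
  (D1' : falgType rat) (D1'_div : division_algebra D1') (D1'_deg : has_degree D1' p1)
  (D1 : falgType F1) (t : D1' -> F1 -> D1) (D1_tensor : is_scalar_extension iota t)
  (D2 : falgType rat) (D2_div : division_algebra D2) (D2_split : split_by iota D2)
  (D2_nontrivial : (1 < \dim {:D2})%N) :
  division_algebra D1 /\
  ~ exists (F : fieldType) (E : falgType F),
      [/\ division_algebra E, contains_ring E D1 & contains_ring E D2].
Proof.
split.
  apply: (scalar_extension_division F1_galois _ D1'_div D1_tensor).
    exact: Num.Theory.pchar_num.
  move=> p theta p_irr p_theta; rewrite D1'_deg coprimeXl //.
  have [q [s [q_irr _ Dq Us s_theta]]] := galois_roots F1_galois theta.
  have -> : (size p).-1 = size s.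
    have /eqp_size-> : p %= q.
      rewrite /eqp !(irreducible_dvdp_root (iota := iota) (x := theta)) //;
        by rewrite Dq root_prod_XsubC.
    by rewrite -(size_map_poly iota) Dq size_prod_XsubC.
  exact: (galois_degree_coprime p2_prime F1_group F1_galois p1_prime p1_neq_p2 q_irr Dq Us).
case=> F [E [[E_div _] [f1 _] [f2 _]]].
pose j : {rmorphism F1 -> E} := f1 \o in_alg D1.
have j_central := procyclic_embeds_centrally E_div j p2_prime F1_galois F1_group.
have [_ D2_central] := D2_div.
have [|x r|u u_neq0 uu0] :=
  split_image_nilpotent D2_central D2_nontrivial (f := f2) (j := j) D2_split.
- by move=> k; apply: (rat_rmorphism_uniq (f2 \o in_alg D2) (j \o iota)).
- by have [c ->] := j_central x; rewrite mulr_algl mulr_algr.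
by have [] := div_mulf_eq0 E_div uu0; apply/eqP.
Qed.
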